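(* With the setting and notation of the context, let $\epsilon>0$, $\beta\in[0,1]$ and $p=2$ or $p=\infty$. Let $N$ be the minimal integer such that $$ \Vert r_N\Vert_p\le\beta\,\epsilon\,e_p(0). $$ Let $E$ and $D$ be an encoder and a decoder associated with this $N$ and an index set $I\subset\{1,\dots,N\}$ with complement $I^c=\{1,\dots,N\}\setminus I$. Assume that for all $i\in I^c$, $$ \epsilon_{i,p}\le\bar\epsilon_{i,p}, $$ where the real numbers $\bar\epsilon_{i,p}$, $i \in I^c$, satisfy $$ \sum_{i\in I^c}\bar\epsilon_{i,2}^{\,2}\le(1-\beta^2)\,\epsilon^2\,e_2(0)^2\quad\text{if }p=2, $$ or $$ \sum_{i\in I^c}\bar\epsilon_{i,\infty}\le(1-\beta)\,\epsilon\,e_\infty(0)\quad\text{if }p=\infty. $$ Then $$ e_p(D\circ E)\le\epsilon\,e_p(0). $$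
   Context: $X$ is a (real) Hilbert space with inner product $(\cdot,\cdot)_X$ and norm $\Vert\cdot\Vert_X$, and $M\subset X$ is a subset. Let $\bar u\in X$ and let $(\varphi_i)_{i\ge1}$ be a (finite or infinite) orthonormal family in $X$. For each $N$ let $X_N=\mathrm{span}\{\varphi_1,\dots,\varphi_N\}$, let $P_{X_N}$ be the orthogonal projection of $X$ onto $X_N$, and for $u\in M$ let $r_N(u)=(id-P_{X_N})(u-\bar u)$. Also let $a_i(u)=(\varphi_i,u-\bar u)_X$, so that $u=\bar u+\sum_{i=1}^N a_i(u)\varphi_i+r_N(u)$. Given $N$, let $I=\{i_1,\dots,i_n\}\subset\{1,\dots,N\}$ have $n$ elements and $I^c=\{1,\dots,N\}\setminus I$. Write $\ell_2(I)$ for $\mathbb{R}^n$ with the Euclidean norm, the $k$-th coordinate $a_k$ of $a\in\ell_2(I)$ corresponding to the index $i_k\in I$. Encoder: $E:X\to\ell_2(I)$, $E(u)=((u-\bar u,\varphi_i)_X)_{i\in I}$ (i.e. its $k$-th coordinate is $(u-\bar u,\varphi_{i_k})_X$). Decoder: $D:\ell_2(I)\to X$, $D(a)=\bar u+\sum_{i=1}^N g_i(a)\varphi_i$, where $g_{i_k}(a)=a_k$ for $k=1,\dots,n$, and for $i\in I^c$, $g_i(a)=f_i((g_j(a))_{j\in S_i})$ with $S_i=\{1,\dots,n_i\}$, $n_i<i$, and $f_i:\mathbb{R}^{n_i}\to\mathbb{R}$ an $n_i$-variate polynomial. Norms and errors: for a map $h$ on $M$ with values in $X$ or $\mathbb{R}$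 (with $\Vert\cdot\Vert$ the norm of $X$ or the absolute value), $\Vert h\Vert_2=\left(\int_M\Vert h(u)\Vert^2d\rho(u)\right)^{1/2}$ and $\Vert h\Vert_\infty=\sup_{u\in M}\Vert h(u)\Vert$. For $p\in\{2,\infty\}$: - $e_p(D\circ E)=\Vert id-D\circ E\Vert_p$, i.e. the norm $\Vert\cdot\Vert_p$ of $u\mapsto u-D(E(u))$; - $e_p(0)=\Vert id\Vert_p$, i.e. $e_2(0)^2=\int_M\Vert u\Vert_X^2d\rho(u)$ and $e_\infty(0)=\sup_{u\in M}\Vert u\Vert_X$; - $\epsilon_{i,p}=\Vert a_i-g_i\circ E\Vert_p$ for $i\in I^c$, i.e. $\epsilon_{i,2}^2=\int_M|a_i(u)-g_i(E(u))|^2d\rho(u)$ and $\epsilon_{i,\infty}=\sup_{u\in M}|a_i(u)-g_i(E(u))|$. Standing assumptions: for $p=2$, $\rho$ is a Borel measure on $M$ with finite second order moment, $e_2(0)<\infty$; for $p=\infty$, $M$ is bounded, i.e. $e_\infty(0)<\infty$. *)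

(* Defs.v *)
From mathcomp Require Import all_boot all_order all_algebra.
From mathcomp Require Import all_classical all_reals all_analysis.
(* No Import: the notations of mpoly clash with those of the analysis library *)
From mathcomp Require mpoly.
Set Implicit Arguments.
Unset Strict Implicit.
Unset Printing Implicit Defensive.
Import Order.TTheory GRing.Theory Num.Theory.
Import numFieldNormedType.Exports.
Local Open Scope classical_set_scope.
Local Open Scope ring_scope.

(* A positive definite symmetric form [ip] that induces the norm of the
   complete space [X] makes [X] a real Hilbert space *)
Definition induces_norm (R : realType) (X : completeNormedModType R)
    (ip : {dot X for idfun}) : Prop :=
  forall x : X, ip x x = `|x| ^+ 2.

(* The sigma-algebra on [X] generated by the open sets and [M]. Its trace on [M]
   is the Borel sigma-algebra of [M] (lemma [borel_with_trace]), and [M] belongs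
   to it even when [M] is not a Borel set. Hence Borel measures on [M] are the
   restrictions to [M] of measures on it. The carrier is [X], and not the subtype
   of [M], because measurable types have to be inhabited *)
Notation borel_with M := (g_sigma_algebraType (open `|` [set M])).

Lemma borel_with_trace (T : ptopologicalType) (M : set T) :
  [set A `&` M | A in <<s open `|` [set M] >>] =
  [set B `&` M | B in <<s (open : set (set T)) >>].
Proof.
set B := <<s open >>; set BM := <<s open `|` [set M] >>.
have sB : sigma_algebra setT B by exact: smallest_sigma_algebra.
have BBM : B `<=` BM by apply: sub_sigma_algebra2; exact: subsetUl.
apply/seteqP; split => _ [A sA <-]; last by exists A => //; exact: BBM.
pose F := [set A | exists2 C, B C & C `&` M = A `&` M].
suff /(_ _ sA)[C sC CA] : BM `<=` F by exists C.
case: sB => B0 BC BU; apply: smallest_sub => [|D [oD|->]]; last 2 first.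
- by exists D => //; exact: sub_sigma_algebra.
- by exists setT; [rewrite -(setD0 setT); exact: BC | rewrite setIid setTI].
split.
- by exists set0.
- move=> D [C sC CD]; exists (setT `\` C); first exact: BC.
  rewrite !setTD; apply/seteqP; split=> x [nx Mx]; split => // Dx; apply: nx.
  + by have [] : (C `&` M) x by rewrite CD.
  + by have [] : (D `&` M) x by rewrite -CD.
- move=> G FG.
  have /choice[C hC] : forall i, exists C, B C /\ C `&` M = G i `&` M.
    by move=> i; have [C ? ?] := FG i; exists C.
  exists (\bigcup_i C i); first by apply: BU => i; have [] := hC i.
  by rewrite !setI_bigcupl; apply: eq_bigcupr => i _; have [] := hC i.
Qed.

Variant exponent := Two | Infty.

(* The element 0 in the supremum matters only when [M] is empty *)
Definition pnorm (R : realType) (X : normedModType R) (M : set X)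
    (rho : {measure set (borel_with M) -> \bar R}) (p : exponent)
    (V : normedZmodType R) (h : X -> V) : \bar R :=
  match p with
  | Two => ((\int[rho]_(u in M) (`|h u| ^+ 2)%:E) `^ 2^-1)%E
  | Infty => ereal_sup (0%E |` [set `|h u|%:E | u in M])
  end.

(* Families are indexed from 0: [phi i] stands for $\varphi_{i+1}$. A family has
   length [L], where [None] means that it is infinite; the values [phi i] beyond
   the length are junk *)
Definition in_family (L : option nat) (i : nat) : bool :=
  if L is Some m then (i < m)%N else true.

Definition admissible_dim (L : option nat) (N : nat) : bool :=
  if L is Some m then (N <= m)%N else true.

Definition orthonormal_family (R : realType) (X : lmodType R)
    (ip : {dot X for idfun}) (L : option nat) (phi : nat -> X) : Prop :=
  forall i j, in_family L i -> in_family L j ->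
    ip (phi i) (phi j) = (i == j)%:R.

Definition span_first (R : realType) (X : lmodType R) (phi : nat -> X)
    (N : nat) : set X :=
  range (fun c : 'I_N -> R => \sum_(i < N) c i *: phi i).

Definition orthogonal_projection (R : realType) (X : lmodType R)
    (ip : {dot X for idfun}) (V : set X) (P : X -> X) : Prop :=
  forall x, V (P x) /\ forall v, V v -> ip (x - P x) v = 0.

Definition residual (X : zmodType) (ubar : X) (P : nat -> X -> X) (N : nat)
    (u : X) : X :=
  (u - ubar) - P N (u - ubar).

Definition coefficient (R : realType) (X : lmodType R)
    (ip : {dot X for idfun}) (ubar : X) (phi : nat -> X) (i : nat) (u : X) : R :=
  ip (phi i) (u - ubar).

(* An index set I with n elements i_1, ..., i_n is the image of an injection
   [idx : 'I_n -> 'I_N] *)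
Definition index_compl (N n : nat) (idx : 'I_n -> 'I_N) : {set 'I_N} :=
  ~: [set idx k | k : 'I_n].

Definition encoder (R : realType) (X : lmodType R)
    (ip : {dot X for idfun}) (ubar : X) (phi : nat -> X) (N n : nat)
    (idx : 'I_n -> 'I_N) (u : X) : 'rV[R]_n :=
  \row_(k < n) ip (u - ubar) (phi (idx k)).

(* [d i] is the number of variables n_i of the polynomial [f i]. With indices
   from 0, S_i is [{0, ..., d i - 1}], and n_i < i becomes [d i <= i] *)
Definition decoder_coefficients (R : realType) (N n : nat)
    (idx : 'I_n -> 'I_N) (d : 'I_N -> nat)
    (f : forall i : 'I_N, mpoly.mpoly (d i) R)
    (g : nat -> 'rV[R]_n -> R) : Prop :=
  (forall (k : 'I_n) (a : 'rV[R]_n), g (idx k) a = a 0 k) /\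
  (forall i : 'I_N, i \in index_compl idx ->
     (d i <= i)%N /\
     forall a : 'rV[R]_n,
       g i a = mpoly.meval (fun j : 'I_(d i) => g j a) (f i)).

Definition decoder (R : realType) (X : lmodType R) (ubar : X)
    (phi : nat -> X) (N n : nat) (g : nat -> 'rV[R]_n -> R) (a : 'rV[R]_n) : X :=
  ubar + \sum_(i < N) g i a *: phi i.

(* Main.v *)
Require Import Defs.
From mathcomp Require Import all_boot all_order all_algebra.
From mathcomp Require Import all_classical all_reals all_analysis.
From mathcomp Require mpoly.
From mathcomp Require Import measurable_realfun ring.
Import Order.TTheory GRing.Theory Num.Theory.
Import numFieldNormedType.Exports.
Local Open Scope classical_set_scope.
Local Open Scope ring_scope.

(** The encoder keeps the coefficients of index in $I$ exactly, so the
    reconstruction error splits into a part orthogonal to $X_N$ and a part inside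
    it that only sees the indices in $I^c$:
    $$u - D(E(u)) = r_N(u) + \sum_{i \in I^c} (a_i(u) - g_i(E(u))) \varphi_i$$
    (lemmas [decoder_error] and [defect_eq0]).

    For $p = 2$, Pythagoras gives the squared norm of the error as the squared
    norm of $r_N(u)$ plus the squares of the defects $a_i - g_i \circ E$.
    Integrating, $e_2(D \circ E)^2 = \|r_N\|_2^2 +
    \sum_{i \in I^c} \epsilon_{i,2}^2$ (lemma [pnorm2_decoder_error]), and the
    two terms are at most $\beta^2 \epsilon^2 e_2(0)^2$ and
    $(1 - \beta^2) \epsilon^2 e_2(0)^2$.

    For $p = \infty$, the triangle inequality with $\|\varphi_i\| = 1$ gives
    $e_\infty(D \circ E) \le \|r_N\|_\infty +
    \sum_{i \in I^c} \epsilon_{i,\infty}$ (lemma [pnormoo_decoder_error]), and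
    the two terms are at most $\beta \epsilon e_\infty(0)$ and
    $(1 - \beta) \epsilon e_\infty(0)$.

    Splitting the integral for $p = 2$ requires measurability. The $a_i$ are
    continuous by polarization. The $g_i \circ E$ are measurable by strong
    induction on $i$, each being some $a_i$ or a polynomial in earlier ones. The
    squared norm of $r_N(u)$ is, by Pythagoras again, that of $u - \bar u$ minus
    the sum of the $a_i(u)^2$ for $i \le N$. *)

Set Implicit Arguments.
Unset Strict Implicit.
Unset Printing Implicit Defensive.

(** * Orthonormal families and projections *)

Section Hilbert.
Variables (R : realType) (X : completeNormedModType R).
Variables (ip : {dot X for idfun}) (hip : induces_norm ip).

Lemma ipC (x y : X) : ip x y = ip y x.
Proof. by rewrite hermC /= expr0 mul1r. Qed.

Lemma ip_polarization (x y : X) :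
  ip x y = (`|x + y| ^+ 2 - `|x - y| ^+ 2) / 4.
Proof. by rewrite -!hip hnormD hnormB /= expr0 !mul1r; field. Qed.

(** By polarization, a consequence of the continuity of the norm. *)
Lemma ip_continuous (x : X) : continuous (ip x).
Proof.
have -> : (ip x : X -> R) =
    (fun y => (`|x + y| * `|x + y| - `|x - y| * `|x - y|) / 4).
  by apply/funext => y; rewrite ip_polarization !expr2.
move=> y.
have cD : `|x + z| @[z --> y] --> `|x + y|.
  by apply: cvg_norm; apply: cvgD; [exact: cvg_cst|exact: cvg_id].
have cB : `|x - z| @[z --> y] --> `|x - y|.
  by apply: cvg_norm; apply: cvgB; [exact: cvg_cst|exact: cvg_id].
exact: (cvgM (cvgB (cvgM cD cD) (cvgM cB cB)) (cvg_cst _)).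
Qed.

Variables (L : option nat) (phi : nat -> X).
Hypothesis hphi : orthonormal_family ip L phi.
Variables (N : nat) (hN : admissible_dim L N).

Lemma in_family_admissible (i : 'I_N) : in_family L i.
Proof.
move: hN; rewrite /admissible_dim /in_family.
by case: L => // m; exact: leq_trans.
Qed.

Lemma orthonormal_norm1 (i : 'I_N) : `|phi i| = 1.
Proof.
by apply/eqP; rewrite -sqrp_eq1// -hip hphi ?in_family_admissible// eqxx.
Qed.

Lemma orthonormal_normD (r : X) (c : 'I_N -> R) :
  (forall i : 'I_N, ip r (phi i) = 0) ->
  `|r + \sum_(i < N) c i *: phi i| ^+ 2 = `|r| ^+ 2 + \sum_(i < N) c i ^+ 2.
Proof.
move=> hr; rewrite -!hip hnormDd; last first.
  by rewrite linear_sumr big1 // => i _; rewrite linearZr_LR /= hr mulr0.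
congr (_ + _); rewrite linear_sumlz; apply: eq_bigr => i _.
rewrite linear_sumr (bigD1 i) //= big1 ?addr0 => [|j ji].
  rewrite linearZl_LR linearZr_LR /= hphi ?in_family_admissible//.
  by rewrite eqxx mulr1 expr2.
rewrite linearZl_LR linearZr_LR /= hphi ?in_family_admissible//.
by rewrite eq_sym (inj_eq val_inj) (negbTE ji) !mulr0.
Qed.

Lemma span_first_mem (i : 'I_N) : span_first phi N (phi i).
Proof.
exists (fun j => (j == i)%:R) => //=; rewrite (bigD1 i) //= eqxx scale1r.
by rewrite big1 ?addr0 // => j /negbTE ->; rewrite scale0r.
Qed.

Lemma orthogonal_projectionE (P : X -> X) (x : X) :
  orthogonal_projection ip (span_first phi N) P ->
  P x = \sum_(i < N) ip (phi i) x *: phi i.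
Proof.
move=> hP; have [[c _ Pc] xP] := hP x.
rewrite -Pc; apply: eq_bigr => i _; congr (_ *: _).
have := xP _ (span_first_mem i).
rewrite linearBl -Pc linear_sumlz (bigD1 i) //= big1 => [|j ji].
  rewrite linearZl_LR /= hphi ?in_family_admissible// eqxx mulr1 addr0.
  by move=> /eqP; rewrite subr_eq0 ipC => /eqP ->.
rewrite linearZl_LR /= hphi ?in_family_admissible//.
by rewrite (inj_eq val_inj) (negbTE ji) mulr0.
Qed.

(** Pythagoras for the splitting of $u - \bar u$ into its residual and its
    projection; all the terms on the right are visibly continuous in $u$, unlike
    the projection, which is only specified by its orthogonality property. *)
Lemma normr_sqr_residual (P : nat -> X -> X) (ubar u : X) :
  orthogonal_projection ip (span_first phi N) (P N) ->
  `|residual ubar P N u| ^+ 2 =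
  `|u - ubar| ^+ 2 - \sum_(i < N) coefficient ip ubar phi i u ^+ 2.
Proof.
move=> hP.
have rphi (i : 'I_N) : ip (residual ubar P N u) (phi i) = 0.
  exact: (hP _).2 (span_first_mem _).
have := orthonormal_normD (fun i => coefficient ip ubar phi i u) rphi.
by rewrite -(orthogonal_projectionE _ hP) subrK => ->; rewrite addrK.
Qed.

End Hilbert.

(** * The norms on functions *)

Section Lp.
Variables (R : realType) (X : completeNormedModType R) (M : set X).

Lemma continuous_measurable_borel_with (h : X -> R) :
  continuous h -> measurable_fun [set: borel_with M] h.
Proof.
move=> /continuousP ch; apply: (measurability _ (RGenOpens.measurableE R)).
move=> _ [_ [a [b ->]] <-]; rewrite setTI.
by apply: sub_sigma_algebra; left; apply: ch; exact: interval_open.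
Qed.

Lemma measurable_borel_with : measurable (M : set (borel_with M)).
Proof. by apply: sub_sigma_algebra; right. Qed.

Lemma measurable_meval n (q : mpoly.mpoly n R)
    (v : 'I_n -> borel_with M -> R) :
  (forall i, measurable_fun setT (v i)) ->
  measurable_fun setT (fun u => mpoly.meval (v ^~ u) q).
Proof.
move=> mv; under eq_fun do rewrite mpoly.mevalE.
apply: measurable_sum => m; apply: measurable_funM; first exact: measurable_cst.
by apply: measurable_prod => i _; exact: measurable_funX.
Qed.

Variable rho : {measure set (borel_with M) -> \bar R}.

Lemma pnorm2_sqr (V : normedZmodType R) (h : X -> V) :
  (pnorm rho Two h ^+ 2 = \int[rho]_(u in M) (`|h u| ^+ 2)%:E)%E.
Proof.
have I0 : (0 <= \int[rho]_(u in M) (`|h u| ^+ 2)%:E)%E.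
  by apply: integral_ge0 => u _; rewrite lee_fin sqr_ge0.
by rewrite /pnorm poweR12_sqrt// sqr_sqrte.
Qed.

Lemma pnorm_ge0 p (V : normedZmodType R) (h : X -> V) : (0 <= pnorm rho p h)%E.
Proof.
by case: p => /=; [exact: poweR_ge0|apply: ereal_sup_ubound; left].
Qed.

Lemma le_pnormoo (V : normedZmodType R) (h : X -> V) u :
  M u -> (`|h u|%:E <= pnorm rho Infty h)%E.
Proof. by move=> Mu; apply: ereal_sup_ubound; right; exists u. Qed.

Lemma pnormoo_le (V : normedZmodType R) (h : X -> V) (C : \bar R) :
  (0 <= C)%E -> (forall u, M u -> (`|h u|%:E <= C)%E) ->
  (pnorm rho Infty h <= C)%E.
Proof.
by move=> C0 hC; apply: ge_ereal_sup => _ [->//|[u Mu <-]]; exact: hC.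
Qed.

(** The norm only integrates over [M], which is measurable by the choice of the
    sigma-algebra, so measurability on the whole space restricts to [M]. *)
Lemma pnorm2_sqrD N (V W : normedZmodType R) (h : X -> V) (r : X -> W)
    (c : 'I_N -> X -> R) :
  measurable_fun [set: borel_with M] (fun u => `|r u| ^+ 2) ->
  (forall i, measurable_fun [set: borel_with M] (c i)) ->
  (forall u, `|h u| ^+ 2 = `|r u| ^+ 2 + \sum_(i < N) c i u ^+ 2) ->
  (pnorm rho Two h ^+ 2 =
    pnorm rho Two r ^+ 2 + \sum_(i < N) pnorm rho Two (c i) ^+ 2)%E.
Proof.
move=> mr mc hE; have mM := measurable_borel_with.
have mE (q : borel_with M -> R) : measurable_fun setT q ->
    measurable_fun (M : set (borel_with M)) (EFin \o q).
  by move=> mq; apply/measurable_EFinP; exact: measurable_funTS.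
have mc2 i : measurable_fun (M : set (borel_with M))
    (fun u : borel_with M => (`|c i u| ^+ 2)%:E).
  by apply: mE; apply: measurable_funX; exact: measurableT_comp.
rewrite !pnorm2_sqr; under [in RHS]eq_bigr do rewrite pnorm2_sqr.
rewrite -(ge0_integral_sum rho mM mc2); last first.
  by move=> i u _; rewrite lee_fin sqr_ge0.
rewrite -ge0_integralD //.
- apply: eq_integral => u _; rewrite hE sumEFin -EFinD; congr (_ + _)%:E.
  by apply: eq_bigr => i _; rewrite real_normK ?num_real.
- exact: mE.
- by move=> u _; apply: sume_ge0 => i _; rewrite lee_fin sqr_ge0.
- exact: emeasurable_sum.
Qed.

End Lp.

(** * The reconstruction error *)

Section Decoder.
Variables (R : realType) (X : completeNormedModType R) (M : set X).
Variable rho : {measure set (borel_with M) -> \bar R}.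
Variables (ip : {dot X for idfun}) (hip : induces_norm ip).
Variables (ubar : X) (L : option nat) (phi : nat -> X).
Hypothesis hphi : orthonormal_family ip L phi.
Variables (N n : nat) (hN : admissible_dim L N) (idx : 'I_n -> 'I_N).
Variables (d : 'I_N -> nat) (f : forall i : 'I_N, mpoly.mpoly (d i) R).
Variables (g : nat -> 'rV[R]_n -> R) (hg : decoder_coefficients idx f g).
Variable P : nat -> X -> X.
Hypothesis hP : orthogonal_projection ip (span_first phi N) (P N).

Let E := encoder ip ubar phi idx.
Let a := coefficient ip ubar phi.
Let defect i u := a i u - g i (E u).
Let error u := u - decoder ubar phi N g (E u).

Lemma measurable_coefficient i : measurable_fun [set: borel_with M] (a i).
Proof.
apply: continuous_measurable_borel_with => u.
apply: (@continuous_comp _ _ _ (fun u => u - ubar) (ip (phi i))).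
  by apply: cvgB; [exact: cvg_id|exact: cvg_cst].
exact: ip_continuous.
Qed.

Lemma decoder_coefficient_idx k u : g (idx k) (E u) = a (idx k) u.
Proof. by rewrite hg.1 mxE (ipC ip). Qed.

Lemma defect_eq0 (i : 'I_N) : i \notin index_compl idx -> defect i = fun=> 0.
Proof.
rewrite inE negbK => /imsetP[k _ ->]; apply/funext => u.
by rewrite /defect decoder_coefficient_idx subrr.
Qed.

(** The polynomial giving coefficient [i] only involves coefficients of smaller
    index, hence the strong induction on [i]. *)
Lemma measurable_decoder_coefficient (i : 'I_N) :
  measurable_fun [set: borel_with M] (fun u => g i (E u)).
Proof.
case: i => i iN /=; elim/ltn_ind: i iN => i IH iN.
have [|] := boolP (Ordinal iN \in index_compl idx); last first.
  rewrite inE negbK => /imsetP[k _ ik].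
  rewrite (_ : (fun _ => _) = a i); first exact: measurable_coefficient.
  apply/funext => u.
  by rewrite -[i]/(nat_of_ord (Ordinal iN)) ik decoder_coefficient_idx.
move=> /(hg.2)[di gi]; rewrite -[i]/(nat_of_ord (Ordinal iN)).
under eq_fun do rewrite gi.
have ji (j : 'I_(d (Ordinal iN))) : (j < i)%N by exact: leq_trans di.
by apply: measurable_meval => j; exact: (IH _ (ji j) (ltn_trans (ji j) iN)).
Qed.

Lemma measurable_defect (i : 'I_N) :
  measurable_fun [set: borel_with M] (defect i).
Proof.
apply: measurable_funB; first exact: measurable_coefficient.
exact: measurable_decoder_coefficient.
Qed.

Lemma measurable_sqr_residual :
  measurable_fun [set: borel_with M] (fun u => `|residual ubar P N u| ^+ 2).
Proof.
under eq_fun do rewrite (normr_sqr_residual hip hphi hN _ _ hP).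
apply: measurable_funB; last first.
  apply: measurable_sum => i; apply: measurable_funX.
  exact: measurable_coefficient.
apply: measurable_funX; apply: continuous_measurable_borel_with => u.
by apply: cvg_norm; apply: cvgB; [exact: cvg_id|exact: cvg_cst].
Qed.

Lemma decoder_error u :
  error u = residual ubar P N u + \sum_(i < N) defect i u *: phi i.
Proof.
have -> : \sum_(i < N) defect i u *: phi i =
    \sum_(i < N) ip (phi i) (u - ubar) *: phi i -
    \sum_(i < N) g i (E u) *: phi i.
  by rewrite -sumrB; apply: eq_bigr => i _; rewrite -scalerBl.
rewrite /residual (orthogonal_projectionE hphi hN _ hP) /error /decoder.
by rewrite opprD addrA addrA subrK.
Qed.

Lemma pnorm2_decoder_error :
  (pnorm rho Two error ^+ 2 = pnorm rho Two (residual ubar P N) ^+ 2 +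
    \sum_(i in index_compl idx) pnorm rho Two (defect i) ^+ 2)%E.
Proof.
rewrite [in RHS]big_mkcond.
rewrite (pnorm2_sqrD rho (c := defect) measurable_sqr_residual
  measurable_defect).
  congr (_ + _)%E; apply: eq_bigr => i _; case: ifPn => // /defect_eq0 ->.
  by rewrite pnorm2_sqr integral0_eq// => u _; rewrite normr0 expr0n.
move=> u; rewrite decoder_error (orthonormal_normD hip hphi hN)// => i.
exact: (hP _).2 (span_first_mem _ _).
Qed.

Lemma pnormoo_decoder_error :
  (pnorm rho Infty error <= pnorm rho Infty (residual ubar P N) +
    \sum_(i in index_compl idx) pnorm rho Infty (defect i))%E.
Proof.
apply: pnormoo_le => [|u Mu].
  by rewrite adde_ge0 ?sume_ge0// => *; exact: pnorm_ge0.
rewrite decoder_error.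
apply: (@le_trans _ _ (`|residual ubar P N u|%:E +
    \sum_(i in index_compl idx) `|defect i u|%:E)%E); last first.
  by apply: leeD; [|apply: lee_sum => i _]; exact: le_pnormoo.
rewrite sumEFin -EFinD lee_fin; apply: le_trans (ler_normD _ _) _.
rewrite lerD2l; apply: le_trans (ler_norm_sum _ _ _) _.
rewrite [leRHS]big_mkcond; apply: ler_sum => i _.
rewrite normrZ (orthonormal_norm1 hip hphi hN) mulr1.
by case: ifPn => // /defect_eq0 ->; rewrite normr0.
Qed.

End Decoder.

Theorem proposition3p2 (R : realType) (X : completeNormedModType R)
  (ip : {dot X for idfun}) (hip : induces_norm ip)
  (M : set X) (ubar : X)
  (L : option nat) (phi : nat -> X) (hphi : orthonormal_family ip L phi)
  (P : nat -> X -> X)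
  (hP : forall N, admissible_dim L N ->
     orthogonal_projection ip (span_first phi N) (P N))
  (p : exponent) (rho : {measure set (borel_with M) -> \bar R})
  (hfin : (pnorm rho p id < +oo)%E)
  (eps beta : R) (heps : 0 < eps) (hbeta : 0 <= beta <= 1)
  (N : nat) (hNL : admissible_dim L N)
  (hN : (pnorm rho p (residual ubar P N)
           <= (beta * eps)%:E * pnorm rho p id)%E)
  (hNmin : forall N', admissible_dim L N' ->
     (pnorm rho p (residual ubar P N')
        <= (beta * eps)%:E * pnorm rho p id)%E -> (N <= N')%N)
  (n : nat) (idx : 'I_n -> 'I_N) (hidx : injective idx)
  (d : 'I_N -> nat) (f : forall i : 'I_N, mpoly.mpoly (d i) R)
  (g : nat -> 'rV[R]_n -> R) (hg : decoder_coefficients idx f g)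
  (ebar : 'I_N -> R)
  (hebar : forall i : 'I_N, i \in index_compl idx ->
     (pnorm rho p (fun u =>
                    coefficient ip ubar phi i u
                    - g i (encoder ip ubar phi idx u))%R
        <= (ebar i)%:E)%E)
  (hsum2 : p = Two ->
     ((\sum_(i in index_compl idx) ebar i ^+ 2)%:E
        <= ((1 - beta ^+ 2) * eps ^+ 2)%:E * pnorm rho p id ^+ 2)%E)
  (hsumoo : p = Infty ->
     ((\sum_(i in index_compl idx) ebar i)%:E
        <= ((1 - beta) * eps)%:E * pnorm rho p id)%E) :
  (pnorm rho p (fun u =>
                u - decoder ubar phi N g (encoder ip ubar phi idx u))%R
     <= eps%:E * pnorm rho p id)%E.
Proof.
have /andP[beta0 beta1] := hbeta.
have [c c0 cE] : exists2 c : R, 0 <= c & pnorm rho p id = c%:E.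
  exists (fine (pnorm rho p id)); first by rewrite fine_ge0 ?pnorm_ge0.
  by rewrite fineK// ge0_fin_numE// pnorm_ge0.
have hPN := hP N hNL; rewrite cE -EFinM.
case: p => [|] in hfin hN hNmin hebar hsum2 hsumoo cE *.
- (* The errors add up in squares, so the squares are compared. *)
  rewrite -lee_sqr ?lee_fin ?mulr_ge0 ?pnorm_ge0 ?(ltW heps)//.
  rewrite (pnorm2_decoder_error rho hip ubar hphi hNL hg hPN) -EFin_expe.
  have -> : (eps * c) ^+ 2 =
      (beta * eps * c) ^+ 2 + (1 - beta ^+ 2) * eps ^+ 2 * c ^+ 2 by ring.
  rewrite EFinD; apply: leeD.
    rewrite EFin_expe lee_sqr ?lee_fin ?mulr_ge0 ?pnorm_ge0 ?(ltW heps)//.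
    by rewrite EFinM -cE.
  rewrite EFinM EFin_expe -cE; apply: le_trans (hsum2 erefl).
  rewrite -sumEFin; apply: lee_sum => i /hebar hi.
  rewrite EFin_expe lee_sqr ?pnorm_ge0//.
  exact: le_trans (pnorm_ge0 _ _ _) hi.
- apply: le_trans (pnormoo_decoder_error rho hip ubar hphi hNL hg hPN) _.
  have -> : eps * c = beta * eps * c + (1 - beta) * eps * c by ring.
  rewrite EFinD; apply: leeD; first by rewrite EFinM -cE.
  rewrite EFinM -cE; apply: le_trans (hsumoo erefl).
  by rewrite -sumEFin; apply: lee_sum => i; exact: hebar.
Qed.
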